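(* For every real $x>0$, $$\frac{1}{2}\psi'(\alpha(x))<\log x-\psi(x)<\frac{1}{2}\psi'(\beta(x)),$$ where $$\alpha(x)=x+\frac{1}{3}\quad\text{and}\quad \beta(x)=\frac{1}{\sqrt{\frac{2}{x}-2\log\left(1+\frac{1}{x}\right)}}.$$
   Context: $\Gamma$ is the classical Euler gamma function, $\psi(x)=\Gamma'(x)/\Gamma(x)$ for $x>0$ is the digamma function, $\psi'$ is its derivative (the trigamma function), and $\log$ is the natural logarithm. *)

(* Defs.v *)
From mathcomp Require Import all_boot all_order all_algebra.
From mathcomp Require Import all_classical all_reals all_analysis.
Set Implicit Arguments.
Unset Strict Implicit.
Unset Printing Implicit Defensive.
Import Order.TTheory GRing.Theory Num.Theory.
Import numFieldNormedType.Exports.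

Local Open Scope classical_set_scope.
Local Open Scope ring_scope.

(* Euler's integral.  The value is the usual Gamma only for 0 < x: otherwise
   the integral diverges and [Rintegral] returns the junk value 0. *)
Definition Gamma {R : realType} (x : R) : R :=
  \int[lebesgue_measure]_(t in `]0, +oo[) (t `^ (x - 1) * expR (- t)).

Definition digamma {R : realType} (x : R) : R := derive1 Gamma x / Gamma x.

Definition trigamma {R : realType} (x : R) : R := derive1 digamma x.

Definition alpha {R : realType} (x : R) : R := x + 1 / 3.

Definition beta {R : realType} (x : R) : R :=
  1 / Num.sqrt (2 / x - 2 * ln (1 + 1 / x)).

(* Main.v *)
Require Import Defs.
From mathcomp Require Import all_boot all_order all_algebra.
From mathcomp Require Import ring lra.
From mathcomp Require Import all_classical all_reals all_analysis.
From mathcomp Require Import measurable_realfun.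
Import Order.TTheory GRing.Theory Num.Theory.
Import numFieldNormedType.Exports.

(* A function D with D (y + 1) <= D y and D y >= - C / y is nonnegative, and it
   is positive if it decreases strictly under the shift. Every inequality on
   the gamma function below is obtained in this way.
   Bernoulli's inequality under Euler's integral gives
   Gamma (x + d) <= x^d Gamma x for 0 <= d <= 1, from which telescoping yields
   |G (x + h) - G x - h psi x| <= C h^2 for G = ln Gamma and
   psi x = lim (ln (x + n) - \sum_(k < n) 1 / (x + k)); so G' = psi, and in the
   same way psi' x = \sum_k 1 / (x + k)^2.
   For the theorem, D is the difference of the two sides. With alpha, positivity
   of D x - D (x + 1) reads alpha(x)^-2 < 2 / x - 2 ln (1 + 1 / x); with beta, the
   same difference is (psi' (beta x + 1) - psi' (beta (x + 1))) / 2, which is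
   positive since psi' decreases and beta' > 1. *)

Local Open Scope classical_set_scope.
Local Open Scope ring_scope.

(** * Positivity by telescoping under the unit shift *)

Section Telescoping.
Context {R : realType}.
Implicit Types (x y C : R) (D : R -> R).

(** A negative value [D x] would bound every [D (x + n)] away from 0 from below zero, while
    [- C / (x + n)] tends to 0. The [n] in the proof makes [n * (- D x)] exceed [C], which is
    already enough for the contradiction. *)
Lemma telescoping_ge0 D x C : 0 < x ->
  (forall y, x <= y -> D (y + 1) <= D y) ->
  (forall y, x <= y -> - (C / y) <= D y) -> 0 <= D x.
Proof.
move=> x0 Dle Dge; rewrite leNgt; apply/negP => Dx0.
pose n := (Num.truncn (C / - D x)).+1.
have Cn : C < n%:R * - D x by rewrite -ltr_pdivrMr ?oppr_gt0// truncnS_gt.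
have Dn : D (x + n%:R) <= D x.
  elim: n {Cn} => [|n IH]; first by rewrite addr0.
  by rewrite -natr1 addrA (le_trans (Dle _ _))// lerDl.
have xn0 : 0 < x + n%:R by rewrite ltr_wpDr.
have := le_trans (Dge (x + n%:R) _) Dn; rewrite lerDl ler0n => /(_ isT).
rewrite lerNl ler_pdivlMr// leNgt => /negP; apply.
by rewrite (lt_le_trans Cn)// mulrC ler_pM2l ?oppr_gt0// lerDr ltW.
Qed.

Lemma telescoping_gt0 D x C : 0 < x ->
  (forall y, x <= y -> D (y + 1) < D y) ->
  (forall y, x <= y -> - (C / y) <= D y) -> 0 < D x.
Proof.
move=> x0 Dlt Dge; apply: le_lt_trans (Dlt x (lexx x)).
apply: (@telescoping_ge0 D (x + 1) C); first by lra.
- by move=> y xy; apply/ltW/Dlt; lra.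
- by move=> y xy; apply/Dge; lra.
Qed.

End Telescoping.

(** * Elementary bounds and a criterion for derivatives *)

Section Bounds.
Context {R : realType}.
Implicit Types (x y d : R).

Lemma ln_sub_le x y : 0 < x -> 0 < y -> ln y - ln x <= (y - x) / x.
Proof.
move=> x0 y0; rewrite -ln_div ?posrE//.
have -> : y / x = 1 + (y - x) / x by field; rewrite gt_eqF.
apply: le_ln1Dx; rewrite ltr_pdivlMr//; lra.
Qed.

Lemma ln_sub_ge x y : 0 < x -> 0 < y -> (y - x) / y <= ln y - ln x.
Proof.
by move=> x0 y0; rewrite -lerN2 opprB -mulNr opprB ln_sub_le.
Qed.

(* [tail x - tail (x + 1) >= x^-2], so [tail x] dominates [\sum_k (x + k)^-2]. *)
Definition tail x : R := x^-1 + x^-2.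

Lemma tail_gt0 x : 0 < x -> 0 < tail x.
Proof. by move=> x0; rewrite addr_gt0 ?invr_gt0 ?exprn_gt0. Qed.

Lemma tail_step x : 0 < x -> tail (x + 1) + x^-2 <= tail x.
Proof.
move=> x0; rewrite /tail -subr_ge0.
have -> : x^-1 + x^-2 - ((x + 1)^-1 + (x + 1)^-2 + x^-2) = (x * (x + 1) ^+ 2)^-1.
  by field; rewrite !gt_eqF//; lra.
by rewrite invr_ge0 mulr_ge0 ?exprn_ge0//; lra.
Qed.

(** Brings [tail] to the form [C / y] that the telescoping lemmas ask for, with [C] depending only
    on the starting point. *)
Lemma tail_le x y : 0 < x -> x <= y -> tail y <= (1 + x^-1) / y.
Proof.
move=> x0 xy; have y0 : 0 < y by lra.
rewrite /tail mulrDl mul1r lerD2l -exprVn expr2 ler_pM2r ?invr_gt0//.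
by rewrite lef_pV2 ?posrE.
Qed.

Lemma is_derive_quadratic (f : R -> R) x l C d : 0 < d ->
  (forall h, `|h| < d -> `|f (x + h) - f x - h * l| <= C * h ^+ 2) ->
  is_derive x 1 f l.
Proof.
move=> d0 H.
suff cv : h^-1 *: (f (h *: 1 + x) - f x) @[h --> 0^'] --> l.
  by apply: DeriveDef; [apply/cvg_ex; exists l | exact: cvg_lim].
apply/cvgrPdist_le => /= e e0; near=> h.
have h0 : h != 0 by near: h; exact: nbhs_dnbhs_neq.
have hd : `|h| < d.
  by near: h; apply/dnbhs0_lt.
(* The sign of [C] is unknown and [C] may be 0, hence the divisor [|C| + 1]. *)
have he : `|h| <= e / (`|C| + 1).
  by near: h; apply/dnbhs0_le; rewrite divr_gt0// ltr_wpDl.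
have h0' : 0 < `|h| by rewrite normr_gt0.
have -> : h *: 1 + x = x + h by rewrite /GRing.scale/= mulr1 addrC.
rewrite distrC.
have -> : h^-1 *: (f (x + h) - f x) - l = h^-1 * (f (x + h) - f x - h * l).
  by rewrite /GRing.scale/=; field.
rewrite normrM normfV mulrC ler_pdivrMr// (le_trans (H h hd))//.
rewrite ler_pdivlMr in he; last by rewrite ltr_wpDl.
rewrite -real_normK ?num_real// expr2 mulrA ler_pM2r//.
rewrite (le_trans _ he)// mulrC ler_pM2l//.
by rewrite (le_trans (ler_norm _))// lerDl.
Unshelve. all: by end_near. Qed.

Lemma gt0_of_derive (f df : R -> R) : f 0 = 0 ->
  (forall t : R, 0 <= t -> is_derive t 1 f (df t)) ->
  (forall t : R, 0 < t -> 0 < df t) -> forall t : R, 0 < t -> 0 < f t.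
Proof.
move=> f0 fd df0 t t0.
have [||c] := @MVT _ f df 0 t t0.
- by move=> z; rewrite in_itv/= => /andP[z0 _]; apply: fd; lra.
- apply: derivable_within_continuous => z; rewrite in_itv/= => /andP[z0 _].
  exact: (@ex_derive _ _ _ _ _ _ _ (fd z z0)).
rewrite in_itv/= f0 !subr0 => /andP[c0 _] ->.
by rewrite mulr_gt0// df0.
Qed.

End Bounds.

(** * The limits [psi] and [psi1], their shift equations and bounds *)

Section Limits.
Context {R : realType}.
Implicit Types (x y d : R) (n : nat).

(** Taking [ln (x + n)] instead of the customary [ln n] makes the sequence monotone, gives it the
    initial value [ln x], and makes the shift identity exact at every finite [n]. *)
Definition psi_seq x n : R := ln (x + n%:R) - \sum_(k < n) (x + k%:R)^-1.

Definition psi x : R := limn (psi_seq x).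

Definition psi1_seq x n : R := \sum_(k < n) (x + k%:R) ^- 2.

Definition psi1 x : R := limn (psi1_seq x).

Lemma psi_seqS x n : psi_seq x n.+1 = psi_seq (x + 1) n - x^-1.
Proof.
rewrite /psi_seq big_ord_recl/= addr0 opprD addrA addrAC.
congr (ln _ - _ - _); first by rewrite -natr1; ring.
by apply: eq_bigr => i _; rewrite /bump/= add1n -natr1; congr (_^-1); ring.
Qed.

Lemma psi1_seqS x n : psi1_seq x n.+1 = psi1_seq (x + 1) n + x ^- 2.
Proof.
rewrite /psi1_seq big_ord_recl/= addr0 addrC; congr (_ + _).
by apply: eq_bigr => i _; rewrite /bump/= add1n -natr1; congr (_ ^- 2); ring.
Qed.

Lemma psi_seq_recr x n :
  psi_seq x n.+1 = psi_seq x n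
                   + (ln (x + n%:R + 1) - ln (x + n%:R) - (x + n%:R)^-1).
Proof. by rewrite /psi_seq big_ord_recr/= -natr1 addrA; ring. Qed.

Lemma psi_seq_nincr x : 0 < x -> nonincreasing_seq (psi_seq x).
Proof.
move=> x0; apply/nonincreasing_seqP => n; rewrite psi_seq_recr gerDl subr_le0.
have xn0 : 0 < x + n%:R by rewrite ltr_wpDr.
rewrite (le_trans (ln_sub_le (x + n%:R) _ xn0 _))//; first by lra.
by rewrite [x + _ + 1]addrC addrK div1r.
Qed.

(** Each increment of [psi_seq x] is at least [(x + n + 1)^-1 - (x + n)^-1], and these telescope;
    the last term on the left carries the induction. *)
Lemma psi_seq_ge x n : 0 < x -> ln x - x^-1 + (x + n%:R)^-1 <= psi_seq x n.
Proof.
move=> x0; elim: n => [|n IH].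
  by rewrite /psi_seq big_ord0 addr0 subr0 subrK.
have xn0 : 0 < x + n%:R by rewrite ltr_wpDr.
rewrite psi_seq_recr -natr1 addrA.
have := ln_sub_ge (x + n%:R) (x + n%:R + 1) xn0 _.
rewrite [x + _ + 1]addrC addrK div1r => /(_ _); lra.
Qed.

Lemma psi_seq_cvg x : 0 < x -> cvgn (psi_seq x).
Proof.
move=> x0; apply: nonincreasing_is_cvgn; first exact: psi_seq_nincr.
exists (ln x - x^-1) => _ [n _ <-].
by rewrite (le_trans _ (psi_seq_ge x n x0))// lerDl invr_ge0 addr_ge0// ltW.
Qed.

Lemma psi_shift x : 0 < x -> psi (x + 1) = psi x + x^-1.
Proof.
move=> x0.
have c : psi_seq x (n + 1)%N @[n --> \oo] --> psi x.
  by rewrite cvg_shiftn; exact: psi_seq_cvg.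
apply/cvg_lim => //.
have -> : psi_seq (x + 1) = (fun n => psi_seq x (n + 1)%N + x^-1).
  by apply/funext => n; rewrite addn1 psi_seqS subrK.
by apply: cvgD => //; exact: cvg_cst.
Qed.

Lemma psi_le_ln x : 0 < x -> psi x <= ln x.
Proof.
move=> x0; have -> : ln x = psi_seq x 0 by rewrite /psi_seq big_ord0 addr0 subr0.
by apply: nonincreasing_cvgn_ge; [exact: psi_seq_nincr | exact: psi_seq_cvg].
Qed.

Lemma psi_ge_ln x : 0 < x -> ln x - x^-1 <= psi x.
Proof.
move=> x0; apply: limr_ge; first exact: psi_seq_cvg.
apply: nearW => n.
by rewrite (le_trans _ (psi_seq_ge x n x0))// lerDl invr_ge0 addr_ge0// ltW.
Qed.

Lemma psi1_seq_ndecr x : 0 < x -> nondecreasing_seq (psi1_seq x).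
Proof.
move=> x0; apply/nondecreasing_seqP => n.
by rewrite /psi1_seq big_ord_recr/= lerDl invr_ge0 exprn_ge0// addr_ge0// ltW.
Qed.

Lemma psi1_seq_le x n : 0 < x -> psi1_seq x n <= tail x.
Proof.
(* The bound is strengthened by [tail (x + n)] so that [tail_step] closes the induction. *)
move=> x0; apply: (@le_trans _ _ (tail x - tail (x + n%:R))); last first.
  by rewrite gerBl ltW// tail_gt0// ltr_wpDr.
elim: n => [|n IH]; first by rewrite /psi1_seq big_ord0 addr0 subrr.
have xn0 : 0 < x + n%:R by rewrite ltr_wpDr.
rewrite /psi1_seq big_ord_recr/= -/(psi1_seq x n) -natr1 addrA.
have := tail_step (x + n%:R) xn0; lra.
Qed.

Lemma psi1_seq_cvg x : 0 < x -> cvgn (psi1_seq x).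
Proof.
move=> x0; apply: nondecreasing_is_cvgn; first exact: psi1_seq_ndecr.
by exists (tail x) => _ [n _ <-]; exact: psi1_seq_le.
Qed.

Lemma psi1_shift x : 0 < x -> psi1 (x + 1) = psi1 x - x ^- 2.
Proof.
move=> x0.
have c : psi1_seq x (n + 1)%N @[n --> \oo] --> psi1 x.
  by rewrite cvg_shiftn; exact: psi1_seq_cvg.
apply/cvg_lim => //.
have -> : psi1_seq (x + 1) = (fun n => psi1_seq x (n + 1)%N - x ^- 2).
  by apply/funext => n; rewrite addn1 psi1_seqS addrK.
by apply: cvgD => //; exact: cvg_cst.
Qed.

Lemma psi1_ge0 x : 0 < x -> 0 <= psi1 x.
Proof.
move=> x0; have -> : 0 = psi1_seq x 0 by rewrite /psi1_seq big_ord0.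
by apply: nondecreasing_cvgn_le; [exact: psi1_seq_ndecr | exact: psi1_seq_cvg].
Qed.

Lemma psi1_le x : 0 < x -> psi1 x <= tail x.
Proof.
move=> x0; apply: limr_le; first exact: psi1_seq_cvg.
by apply: nearW => n; exact: psi1_seq_le.
Qed.

Lemma psi1_decreasing x y : 0 < x -> x < y -> psi1 y < psi1 x.
Proof.
move=> x0 xy; rewrite -subr_gt0.
pose d := y - x; have -> : y = x + d by rewrite /d; ring.
have d0 : 0 < d by rewrite /d; lra.
pose D z : R := psi1 z - psi1 (z + d).
apply: (@telescoping_gt0 _ D x (1 + x^-1) x0) => z xz; rewrite /D.
  rewrite addrAC !psi1_shift; [|lra..].
  suff : (z + d) ^- 2 < z ^- 2 by lra.
  by rewrite ltf_pV2 ?posrE ?exprn_gt0 ?ltrXn2r//; lra.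
have zd0 : 0 < z + d by lra.
have h1 := psi1_ge0 z; have h2 := psi1_le (z + d) zd0.
have := tail_le x (z + d) x0 _.
have : (1 + x^-1) / (z + d) <= (1 + x^-1) / z.
  rewrite ler_pM2l; last by rewrite addr_gt0 ?invr_gt0.
  by rewrite lef_pV2 ?posrE; lra.
by lra.
Qed.

(** Under the unit shift [psi (z + d) - psi z] drops by [1/z - 1/(z + d) = d / (z (z + d))]. This is
    nonnegative and at most [d / z^2], hence at most the drop of [d * tail z]; telescoping gives
    both bounds. *)
Lemma psi_increment x d : 0 < x -> 0 <= d ->
  0 <= psi (x + d) - psi x <= d * tail x.
Proof.
move=> x0 d0; apply/andP; split.
  pose D z : R := psi (z + d) - psi z.
  apply: (@telescoping_ge0 _ D x 1 x0) => z xz; rewrite /D.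
    rewrite addrAC !psi_shift; [|lra..].
    suff : (z + d)^-1 <= z^-1 by lra.
    by rewrite lef_pV2 ?posrE; lra.
  have zd0 : 0 < z + d by lra.
  have z0 : 0 < z by lra.
  have h1 := psi_ge_ln (z + d) zd0; have h2 := psi_le_ln z z0.
  have : (z + d)^-1 <= z^-1 by rewrite lef_pV2 ?posrE; lra.
  have : ln z <= ln (z + d) by rewrite ler_ln ?posrE; lra.
  by lra.
rewrite -subr_ge0.
pose D z : R := d * tail z - (psi (z + d) - psi z).
apply: (@telescoping_ge0 _ D x (d + 1) x0) => z xz; rewrite /D.
  have z0 : 0 < z by lra.
  rewrite [z + 1 + d]addrAC !psi_shift; [|lra..].
  have := ler_wpM2l d0 (tail_step z z0); rewrite mulrDr.
  have : z^-1 - (z + d)^-1 <= d * z ^- 2.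
    have -> : z^-1 - (z + d)^-1 = d * (z * (z + d))^-1.
      by field; rewrite !gt_eqF//; lra.
    rewrite ler_wpM2l// lef_pV2 ?posrE ?exprn_gt0// ?mulr_gt0//; nra.
  lra.
have zd0 : 0 < z + d by lra.
have z0 : 0 < z by lra.
have h1 := psi_le_ln (z + d) zd0; have h2 := psi_ge_ln z z0.
have h3 := ln_sub_le z (z + d) z0 zd0.
have h4 : 0 <= d * tail z by rewrite mulr_ge0// ltW// tail_gt0.
rewrite [z + d]addrC addrK in h3; rewrite mulrDl div1r; rewrite [z + d]addrC.
rewrite [z + d]addrC in h1.
by lra.
Qed.

End Limits.

(** * Differentiation of [psi] *)

Section Derivatives.
Context {R : realType}.
Implicit Types (x y d h : R).

Lemma tail_nincr x y : 0 < x -> x <= y -> tail y <= tail x.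
Proof.
move=> x0 xy; have y0 : 0 < y by lra.
by rewrite lerD ?lef_pV2 ?posrE ?exprn_gt0// lerXn2r ?nnegrE// ltW.
Qed.

Lemma psi_lipschitz x h : 0 < x -> 0 < x + h ->
  `|psi (x + h) - psi x| <= `|h| * (tail x + tail (x + h)).
Proof.
move=> x0 xh0; have t1 := tail_gt0 x x0; have t2 := tail_gt0 _ xh0.
have [h0|h0] := leP 0 h.
  have /andP[i1 i2] := psi_increment x h x0 h0.
  by rewrite !ger0_norm//; nra.
have nh0 : 0 <= - h by lra.
have /andP[] := psi_increment (x + h) (- h) xh0 nh0.
rewrite addrK => i1 i2.
by rewrite distrC ger0_norm// ltr0_norm//; nra.
Qed.

(** The first-order remainder [D] grows under the unit shift by exactly [h^2 / (z^2 (z + h))]. For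
    [|h| < x / 2] this lies between 0 and [(2 / x) h^2] times the drop of [tail], so telescoping
    [- D] and [(2 / x) h^2 tail + D] encloses [D x] quadratically in [h]. *)
Lemma is_derive_psi x : 0 < x -> is_derive x 1 psi (psi1 x).
Proof.
move=> x0; have x20 : 0 < x / 2 by lra.
apply: (@is_derive_quadratic _ psi x (psi1 x) (2 / x * tail x) (x / 2)) => // h.
rewrite ltr_norml => /andP[h1 h2].
pose D z : R := psi (z + h) - psi z - h * psi1 z.
have step z : x <= z -> D (z + 1) - D z = h ^+ 2 * (z ^- 2 * (z + h)^-1).
  move=> xz; rewrite /D [z + 1 + h]addrAC !psi_shift ?psi1_shift; [|lra..].
  by field; rewrite !gt_eqF//; lra.
have step_ge0 z : x <= z -> 0 <= z ^- 2 * (z + h)^-1.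
  by move=> xz; rewrite mulr_ge0 ?invr_ge0 ?exprn_ge0//; lra.
have step_le z : x <= z -> z ^- 2 * (z + h)^-1 <= 2 / x * (tail z - tail (z + 1)).
  move=> xz; have z0 : 0 < z by lra.
  have t := tail_step z z0.
  have v : (z + h)^-1 <= 2 / x.
    by rewrite -[2 / x]invf_div lef_pV2 ?posrE//; lra.
  rewrite mulrC ler_pM ?invr_ge0 ?exprn_ge0//; lra.
(* [D z] is at most [|h|] times three tails: two from [psi_lipschitz], one from [psi1 z]. Each is at
   most [2 (1 + (x / 2)^-1) / z], because [z + h >= z / 2]. Only decay in [z] matters here; the
   factor [h^2] comes from [step]. *)
pose K : R := `|h| * (3 * (2 * (1 + (x / 2)^-1))).
have DK z : x <= z -> `|D z| <= K / z.
  move=> xz; have z0 : 0 < z by lra.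
  have zh0 : 0 < z + h by lra.
  have c0 : 0 < 1 + (x / 2)^-1 by rewrite addr_gt0 ?invr_gt0.
  have t1 : tail z <= 2 * (1 + (x / 2)^-1) / z.
    have xz2 : x / 2 <= z by lra.
    rewrite (le_trans (tail_le _ _ x20 xz2))//.
    by rewrite ler_pM2r ?invr_gt0//; lra.
  have t2 : tail (z + h) <= 2 * (1 + (x / 2)^-1) / z.
    have xz2 : x / 2 <= z + h by lra.
    rewrite (le_trans (tail_le _ _ x20 xz2))//.
    rewrite [2 * _]mulrC -mulrA ler_pM2l//.
    by rewrite -[2 / z]invf_div lef_pV2 ?posrE; lra.
  have l := psi_lipschitz z h z0 zh0.
  have p0 := psi1_ge0 z z0; have p1 := psi1_le z z0.
  rewrite (le_trans (ler_normB _ _))// normrM (ger0_norm p0).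
  have -> : K / z = `|h| * (3 * (2 * (1 + (x / 2)^-1) / z)) by rewrite /K; ring.
  rewrite (le_trans (lerD l (lexx _)))// -mulrDr ler_wpM2l//; lra.
have D_le0 : D x <= 0.
  rewrite -oppr_ge0; apply: (@telescoping_ge0 _ (fun z => - D z) x K x0) => z xz.
    by have := step z xz; have := mulr_ge0 (sqr_ge0 h) (step_ge0 z xz); lra.
  by have := DK z xz; rewrite ler_norml => /andP[_]; lra.
rewrite -/(D x) ler0_norm// -subr_ge0 opprK.
pose c := 2 / x * h ^+ 2.
have c0 : 0 <= c by rewrite mulr_ge0 ?sqr_ge0// divr_ge0//; lra.
have := @telescoping_ge0 _ (fun z => c * tail z + D z) x K x0 _ _.
rewrite /c; rewrite [_ * tail x]mulrAC; apply => z xz.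
  have := step z xz; have := ler_wpM2l (sqr_ge0 h) (step_le z xz).
  rewrite -/c.
  have -> : h ^+ 2 * (2 / x * (tail z - tail (z + 1))) = c * tail z - c * tail (z + 1).
    by rewrite /c; ring.
  by lra.
rewrite -/c.
have z0 : 0 < z by lra.
have := DK z xz; rewrite ler_norml => /andP[+ _].
have := mulr_ge0 c0 (ltW (tail_gt0 z z0)); lra.
Qed.

(** * Differentiability from the functional equation and an increment bound, in the manner of Bohr
    and Mollerup *)

Section BohrMollerup.
Variable G : R -> R.
Hypothesis G_shift : forall x, 0 < x -> G (x + 1) = G x + ln x.
Hypothesis G_increment : forall x d, 0 < x -> 0 <= d <= 1 ->
  G (x + d) <= G x + d * ln x.

(** The remainder [D] drops under the unit shift by [d / z - (ln (z + d) - ln z)], which lies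
    between 0 and [d^2 / z^2]. The increment hypothesis supplies the decay of [D] at infinity. *)
Lemma bohr_mollerup_quadratic x d : 0 < x -> 0 <= d <= 1 ->
  0 <= G (x + d) - G x - d * psi x <= d ^+ 2 * tail x.
Proof.
move=> x0 d01; have /andP[d0 d1] := d01.
pose D z : R := G (z + d) - G z - d * psi z.
have step z : x <= z -> D z - D (z + 1) = d * z^-1 - (ln (z + d) - ln z).
  move=> xz; rewrite /D [z + 1 + d]addrAC !G_shift ?psi_shift; [|lra..].
  by ring.
have lnl z : x <= z -> ln (z + d) - ln z <= d * z^-1.
  move=> xz; have z0 : 0 < z by lra.
  have zd0 : 0 < z + d by lra.
  by have := ln_sub_le z (z + d) z0 zd0; rewrite [X in X - z]addrC addrK.
have lng z : x <= z -> d * (z + d)^-1 <= ln (z + d) - ln z.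
  move=> xz; have z0 : 0 < z by lra.
  have zd0 : 0 < z + d by lra.
  by have := ln_sub_ge z (z + d) z0 zd0; rewrite [X in X - z]addrC addrK.
apply/andP; split.
  apply: (@telescoping_ge0 _ D x 1 x0) => z xz.
    by have := step z xz; have := lnl z xz; lra.
  have z0 : 0 < z by lra.
  have zd0 : 0 < z + d by lra.
  (* The increment bound from [z + d] up to [z + 1] bounds [G (z + d)] from below, as [G (z + 1)] is
     known. *)
  have d'01 : 0 <= 1 - d <= 1 by lra.
  have := G_increment (z + d) (1 - d) zd0 d'01.
  have -> : z + d + (1 - d) = z + 1 by ring.
  rewrite G_shift// /D => g.
  have l := lnl z xz; have p := psi_le_ln z z0.
  have dp : d * psi z <= d * ln z by rewrite ler_wpM2l.
  have zi : 0 < z^-1 by rewrite invr_gt0.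
  have : (1 - d) * (ln (z + d) - ln z) <= (1 - d) * (d * z^-1).
    by rewrite ler_wpM2l//; lra.
  have : (1 - d) * (d * z^-1) <= z^-1.
    by rewrite mulrA ger_pMl//; nra.
  rewrite div1r; lra.
rewrite -subr_ge0.
apply: (@telescoping_ge0 _ (fun z => d ^+ 2 * tail z - D z) x 1 x0) => z xz.
  have z0 : 0 < z by lra.
  have s := step z xz; have l := lng z xz.
  have := ler_wpM2l (sqr_ge0 d) (tail_step z z0); rewrite mulrDr.
  have : d * z^-1 - d * (z + d)^-1 <= d ^+ 2 * z ^- 2.
    have -> : d * z^-1 - d * (z + d)^-1 = d ^+ 2 * (z * (z + d))^-1.
      by field; rewrite !gt_eqF//; lra.
    rewrite ler_wpM2l ?sqr_ge0// lef_pV2 ?posrE ?exprn_gt0// ?mulr_gt0//; nra.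
  lra.
have z0 : 0 < z by lra.
have t : 0 <= d ^+ 2 * tail z by rewrite mulr_ge0 ?sqr_ge0// ltW// tail_gt0.
have := G_increment z d z0 d01; have := psi_ge_ln z z0.
have zi : 0 < z^-1 by rewrite invr_gt0.
rewrite /D div1r => p g.
have : d * (ln z - z^-1) <= d * psi z by rewrite ler_wpM2l.
nra.
Qed.

Lemma is_derive_bohr_mollerup x : 0 < x -> is_derive x 1 G (psi x).
Proof.
move=> x0; pose e := Num.min 1 (x / 2).
have e0 : 0 < e by rewrite lt_min ltr01 divr_gt0.
apply: (@is_derive_quadratic _ G x (psi x) (tail (x / 2)) e) => // h.
rewrite lt_min ltr_norml => /andP[/andP[h1 h2]].
rewrite ltr_norml => /andP[h3 h4].
have x20 : 0 < x / 2 by lra.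
have [h0|h0] := leP 0 h.
  have h01 : 0 <= h <= 1 by lra.
  have /andP[q1 q2] := bohr_mollerup_quadratic x h x0 h01.
  rewrite ger0_norm// (le_trans q2)// mulrC ler_wpM2r ?sqr_ge0//.
  by apply: tail_nincr => //; lra.
(* For [h < 0] the expansion is made at [x + h] with step [- h]. Replacing [psi (x + h)] by [psi x]
   turns the remainder into a difference of two quantities, both between 0 and
   [h^2 * tail (x + h)]. *)
have y0 : 0 < x + h by lra.
have d01 : 0 <= - h <= 1 by lra.
have nh0 : 0 <= - h by lra.
have /andP[] := bohr_mollerup_quadratic (x + h) (- h) y0 d01.
have /andP[] := psi_increment (x + h) (- h) y0 nh0.
rewrite addrK sqrrN => p1 p2 q1 q2.
have t : h ^+ 2 * tail (x + h) <= tail (x / 2) * h ^+ 2.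
  by rewrite mulrC ler_wpM2r ?sqr_ge0// tail_nincr//; lra.
have p3 : 0 <= (- h) * (psi x - psi (x + h)) <= h ^+ 2 * tail (x + h).
  have := ler_wpM2l nh0 p2; have := mulr_ge0 nh0 p1.
  by rewrite mulrA mulrNN -expr2 => -> ->.
by rewrite ler_norml; lra.
Qed.

End BohrMollerup.
End Derivatives.

(** * Logarithmic inequalities and the function [beta] *)

Section Elementary.
Context {R : realType}.
Implicit Types (x y t : R).

Lemma is_derive_ln1D t : 0 <= t -> is_derive t (1 : R) (fun s => ln (1 + s)) (1 + t)^-1.
Proof.
move=> t0; have t1 : 0 < 1 + t by lra.
have dl := is_derive1_ln t1.
have d1 : is_derive t 1 (fun s : R => 1 + s) 1.
  by have := @is_deriveD R R R (cst 1) id t 1 0 1 _ _; rewrite add0r; exact.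
by have := @is_derive1_comp R (@ln R) (fun s => 1 + s) t _ _ dl d1; rewrite mulr1.
Qed.

(** Both sides vanish at 0, and the derivatives compare because [(1 + t / 3)^3 > 1 + t]. At
    [t = 1 / x] this is [gap_alpha]. *)
Lemma ln1D_lower t : 0 < t -> t ^+ 2 / (2 * (1 + t / 3) ^+ 2) < t - ln (1 + t).
Proof.
move=> t0; rewrite -subr_gt0; move: t t0.
apply: (@gt0_of_derive R (fun t => t - ln (1 + t) - t ^+ 2 / (2 * (1 + t / 3) ^+ 2))
  (fun t => t / (1 + t) - t / (1 + t / 3) ^+ 3)).
- by rewrite addr0 ln1 expr0n/= mul0r !subrr.
- move=> t t0; have dl := is_derive_ln1D t t0.
  have n0 : 2 * (1 + t / 3) ^+ 2 != 0 by rewrite mulf_neq0 ?expf_neq0// gt_eqF//; lra.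
  apply: is_derive_eq.
  by rewrite /GRing.scale/=; field; rewrite !gt_eqF//; lra.
- move=> t t0; rewrite subr_gt0 ltr_pM2l// ltf_pV2 ?posrE ?exprn_gt0//; [|lra..].
  nra.
Qed.

(** The exponential is [(1 + t)^(-2/3)], the power for which the cube at [t = 1 / x] is exactly
    [dbeta x > 1]. The derivative of the difference has the sign of [E t * (1 + 2 t / 3) - 1],
    positive since [(1 + 2 t / 3)^3 > (1 + t)^2]. *)
Lemma ln1D_upper t : 0 < t ->
  2 * (t - ln (1 + t)) < t ^+ 2 * expR (- (2 / 3) * ln (1 + t)).
Proof.
move=> t0; rewrite -subr_gt0; move: t t0.
pose E t : R := expR (- (2 / 3) * ln (1 + t)).
apply: (@gt0_of_derive R (fun t => t ^+ 2 * E t - 2 * (t - ln (1 + t)))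
  (fun t => E t * (2 * t - 2 / 3 * t ^+ 2 / (1 + t)) - 2 * (1 - (1 + t)^-1))).
- by rewrite addr0 ln1 expr0n/= mul0r !subrr mulr0 subrr.
- move=> t t0; have dl := is_derive_ln1D t t0.
  have dE : is_derive t 1 E (E t * (- (2 / 3) * (1 + t)^-1)).
    have dm : is_derive t 1 (fun s : R => - (2 / 3) * ln (1 + s))
                        (- (2 / 3) * (1 + t)^-1).
      by apply: is_derive_eq; rewrite /GRing.scale/=; ring.
    exact: (@is_derive1_comp R (@expR R) (fun s => - (2 / 3) * ln (1 + s)) t).
  apply: is_derive_eq.
  by rewrite /GRing.scale/=; field; rewrite !gt_eqF//; lra.
- move=> t t0.
  have t10 : 0 < 1 + t by lra.
  have E0 : 0 < E t by exact: expR_gt0.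
  have E3 : E t ^+ 3 = (1 + t) ^- 2.
    rewrite /E -expRM_natl; have -> : 3%:R * (- (2 / 3) * ln (1 + t)) = - (2%:R * ln (1 + t)).
      by field.
    by rewrite expRN expRM_natl lnK.
  have key : 1 < E t * (1 + 2 / 3 * t).
    rewrite ltNge; apply/negP => le1.
    have : (E t * (1 + 2 / 3 * t)) ^+ 3 <= 1 by rewrite exprn_ile1// mulr_ge0//; lra.
    rewrite exprMn E3 mulrC ler_pdivrMr ?exprn_gt0// mul1r.
    nra.
  have -> : E t * (2 * t - 2 / 3 * t ^+ 2 / (1 + t)) - 2 * (1 - (1 + t)^-1) =
    2 * t / (1 + t) * (E t * (1 + 2 / 3 * t) - 1).
    by field; rewrite gt_eqF.
  by rewrite !mulr_gt0 ?invr_gt0// subr_gt0.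
Qed.

(** The radicand in [beta], and also twice the drop of [ln - psi] from [x] to [x + 1]. *)
Definition gap x : R := 2 / x - 2 * ln (1 + 1 / x).

Lemma gapE x : gap x = 2 * (x^-1 - ln (1 + x^-1)).
Proof. by rewrite /gap div1r; ring. Qed.

Lemma ln_succ x : 0 < x -> ln (x + 1) - ln x = ln (1 + x^-1).
Proof.
move=> x0; rewrite -ln_div ?posrE//; last by lra.
by congr ln; field; rewrite gt_eqF.
Qed.

Lemma gap_alpha x : 0 < x -> (alpha x) ^- 2 < gap x.
Proof.
move=> x0; have xi : 0 < x^-1 by rewrite invr_gt0.
have := ln1D_lower _ xi; rewrite gapE.
have -> : x^-1 ^+ 2 / (2 * (1 + x^-1 / 3) ^+ 2) = (alpha x) ^- 2 / 2.
  by rewrite /alpha; field; rewrite !gt_eqF//; lra.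
lra.
Qed.

Lemma gap_gt0 x : 0 < x -> 0 < gap x.
Proof.
move=> x0; apply: lt_trans (gap_alpha x x0).
by rewrite invr_gt0 exprn_gt0// /alpha; lra.
Qed.

Lemma betaE x : beta x = (Num.sqrt (gap x))^-1.
Proof. by rewrite /beta div1r. Qed.

Lemma beta_gt0 x : 0 < x -> 0 < beta x.
Proof. by move=> x0; rewrite betaE invr_gt0 sqrtr_gt0 gap_gt0. Qed.

Lemma beta_sqr x : 0 < x -> (beta x) ^- 2 = gap x.
Proof.
by move=> x0; rewrite betaE exprVn invrK sqr_sqrtr// ltW// gap_gt0.
Qed.

Definition dbeta x : R := (Num.sqrt (gap x) ^+ 3 * (x ^+ 2 * (x + 1)))^-1.

Lemma is_derive_beta x : 0 < x -> is_derive x 1 beta (dbeta x).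
Proof.
move=> x0; have x1 : 0 < 1 + 1 / x by rewrite div1r addr_gt0 ?invr_gt0.
have g0 := gap_gt0 x x0.
have xn0 : x != 0 by rewrite gt_eqF.
have di : is_derive x 1 (fun y : R => y^-1) (- x ^- 2).
  by have := @is_deriveV R id x 1 1 xn0 _; rewrite /GRing.scale/= mulr1; exact.
have du : is_derive x 1 (fun y : R => 1 + 1 / y) (- x ^- 2).
  by apply: is_derive_eq; rewrite /GRing.scale/=; field.
have dl := @is_derive1_comp R (@ln R) (fun y => 1 + 1 / y) x _ _ (is_derive1_ln x1) du.
have dl' : is_derive x 1 (fun y : R => ln (1 + 1 / y)) _ := dl.
have dg : is_derive x 1 gap (- 2 / (x ^+ 2 * (x + 1))).
  apply: is_derive_eq.
  by rewrite /GRing.scale/=; field; rewrite !gt_eqF//; lra.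
have ds := is_derive1_sqrt g0.
have s0 : Num.sqrt (gap x) != 0 by rewrite gt_eqF// sqrtr_gt0.
have dc : is_derive x 1 (fun y => Num.sqrt (gap y)) _ := is_derive1_comp ds dg.
have -> : beta = (fun y => (Num.sqrt (gap y))^-1) by apply/funext => z; rewrite betaE.
have dv := @is_deriveV R (fun y => Num.sqrt (gap y)) x _ _ s0 dc.
apply: is_derive_eq.
by rewrite /dbeta /GRing.scale/=; field; rewrite s0 !gt_eqF//; lra.
Qed.

Lemma dbeta_gt1 x : 0 < x -> 1 < dbeta x.
Proof.
move=> x0; have xi : 0 < x^-1 by rewrite invr_gt0.
have g0 := gap_gt0 x x0.
have u0 : 0 < Num.sqrt (gap x) ^+ 3 * (x ^+ 2 * (x + 1)).
  by rewrite !mulr_gt0 ?exprn_gt0 ?sqrtr_gt0//; lra.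
(* Squaring removes the root and leaves [gap x ^ 3 * x^4 (x + 1)^2 < 1], the cube of [ln1D_upper] at
   [1 / x]. *)
rewrite /dbeta invf_gt1// -(@ltr_pXn2r _ 2) ?nnegrE ?ler01 1?ltW//.
rewrite expr1n exprMn exprAC sqr_sqrtr; last exact: ltW.
have := ln1D_upper _ xi; rewrite -gapE; set E := expR _ => gE.
have E3 : E ^+ 3 = (1 + x^-1) ^- 2.
  rewrite /E -expRM_natl.
  have -> : 3%:R * (- (2 / 3) * ln (1 + x^-1)) = - (2%:R * ln (1 + x^-1)) by field.
  by rewrite expRN expRM_natl lnK// posrE addr_gt0.
have : gap x ^+ 3 < (x^-1 ^+ 2 * E) ^+ 3 by rewrite ltrXn2r ?nnegrE// ltW.
rewrite exprMn E3 => g3.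
have p0 : 0 < (x ^+ 2 * (x + 1)) ^+ 2 by rewrite exprn_gt0// mulr_gt0 ?exprn_gt0//; lra.
rewrite -(ltr_pM2r p0) in g3; apply: lt_le_trans g3 _.
rewrite le_eqVlt; apply/orP; left; apply/eqP.
by field; rewrite !gt_eqF//; lra.
Qed.

Lemma beta_succ x : 0 < x -> beta x + 1 < beta (x + 1).
Proof.
move=> x0.
have [|||c] := @MVT R beta dbeta x (x + 1).
- by lra.
- by move=> z; rewrite in_itv/= => /andP[z0 _]; apply: is_derive_beta; lra.
- apply: derivable_within_continuous => z; rewrite in_itv/= => /andP[z0 _].
  have z0' : 0 < z by lra.
  exact: (@ex_derive _ _ _ _ _ _ _ (is_derive_beta z z0')).
rewrite in_itv/= => /andP[c0 _].
have := dbeta_gt1 c (lt_trans x0 c0).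
by rewrite [x + 1 - x]addrAC subrr add0r mulr1; lra.
Qed.

End Elementary.

(** * The two inequalities for [psi] and [psi1] *)

Section AlphaBeta.
Context {R : realType}.
Implicit Types x : R.

Lemma psi1_alpha_lt x : 0 < x -> psi1 (alpha x) / 2 < ln x - psi x.
Proof.
move=> x0; rewrite -subr_gt0.
apply: (@telescoping_gt0 _ (fun y => ln y - psi y - psi1 (alpha y) / 2) x
         (1 + x^-1) x0) => y xy; have y0 : 0 < y by lra.
  have a0 : 0 < alpha y by rewrite /alpha; lra.
  have -> : alpha (y + 1) = alpha y + 1 by rewrite /alpha; ring.
  rewrite psi_shift// psi1_shift//.
  have := gap_alpha y y0; rewrite gapE -ln_succ//; lra.
have a0 : 0 < alpha y by rewrite /alpha; lra.
have ya : y <= alpha y by rewrite /alpha; lra.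
have := psi1_le _ a0; have := tail_nincr _ _ y0 ya; have := tail_le _ _ x0 xy.
have := tail_gt0 _ y0; have := psi_le_ln _ y0; lra.
Qed.

Lemma lt_psi1_beta x : 0 < x -> ln x - psi x < psi1 (beta x) / 2.
Proof.
move=> x0; rewrite -subr_gt0.
apply: (@telescoping_gt0 _ (fun y => psi1 (beta y) / 2 - (ln y - psi y)) x
         1 x0) => y xy; have y0 : 0 < y by lra.
  have b0 := beta_gt0 y y0.
  have b10 : 0 < beta y + 1 by lra.
  (* The shift of [psi1] at [beta y] costs [(beta y)^-2 = gap y], which cancels the drop of
     [ln - psi]; only the comparison of [beta y + 1] with [beta (y + 1)] remains. *)
  have := psi1_decreasing _ _ b10 (beta_succ y y0).
  rewrite psi_shift// psi1_shift// beta_sqr// gapE -ln_succ//; lra.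
have b0 := psi1_ge0 _ (beta_gt0 y y0).
have := psi_ge_ln _ y0; rewrite div1r; lra.
Qed.

End AlphaBeta.

(** * Euler's integral and integration by parts *)

Section GammaIntegral.
Context {R : realType}.
Notation mu := (@lebesgue_measure R).
Implicit Types (x y a b d t : R).

Definition gammaf x t : R := t `^ (x - 1) * expR (- t).

Lemma gammaf_ge0 x t : 0 <= gammaf x t.
Proof. by rewrite mulr_ge0 ?powR_ge0 ?expR_ge0. Qed.

Lemma gammafS x t : 0 < t -> gammaf (x + 1) t = t * gammaf x t.
Proof.
move=> t0; rewrite /gammaf addrK mulrA; congr (_ * _).
rewrite -{2}[t]powRr1 ?ltW// -powRD; last by rewrite (gt_eqF t0) implybT.
by congr (_ `^ _); ring.
Qed.

Lemma measurable_gammaf x (D : set R) : measurable_fun D (fun t => (gammaf x t)%:E).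
Proof.
apply/measurable_EFinP/measurable_funTS/measurable_funM.
  exact: measurable_powR.
by apply: measurableT_comp; [exact: measurable_expR | exact: oppr_measurable].
Qed.

Lemma is_derive_continuous (F : R -> R) t l :
  is_derive t 1 F l -> {for t, continuous F}.
Proof.
by move=> dF; apply: differentiable_continuous; apply/derivable1_diffP;
  exact: (@ex_derive _ _ _ _ _ _ _ dF).
Qed.

Lemma gammaf_continuous x t : 0 < t -> {for t, continuous (gammaf x)}.
Proof.
move=> t0; apply: differentiable_continuous; apply/derivable1_diffP.
apply: derivableM; last exact: ex_derive.
by apply: derivable_powR; rewrite in_itv/= t0.
Qed.

(** Extended-real values let the functional equation be proved before finiteness, which is then
    deduced from it. *)
Definition egamma x : \bar R := (\int[mu]_(t in `]0%R, +oo[) (gammaf x t)%:E)%E.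

Lemma egamma_ge0 x : (0 <= egamma x)%E.
Proof. by apply: integral_ge0 => t _; rewrite lee_fin gammaf_ge0. Qed.

Lemma egamma1 : egamma 1 = 1%E.
Proof.
rewrite /egamma integral_itv_obnd_cbnd; last exact: measurable_gammaf.
have E0 t : gammaf 1 t = expR (- t) by rewrite /gammaf subrr powRr0 mul1r.
under eq_integral do rewrite E0.
have dF t : is_derive t (1 : R) (fun s : R => - expR (- s)) (expR (- t)).
  have dN : is_derive t (1 : R) (fun s : R => - s) (-1) by exact: is_deriveNid.
  have := @is_derive1_comp R (@expR R) (fun s => - s) t _ _ (is_derive_expR _) dN.
  move=> dc; have dc' : is_derive t 1 (fun s : R => expR (- s)) _ := dc.
  by apply: is_derive_eq; ring.
rewrite (@ge0_continuous_FTC2y _ _ (fun s => - expR (- s)) 0 0).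
- by rewrite oppr0 expR0 EFinN oppeK add0e.
- by move=> t _; exact: expR_ge0.
- apply: continuous_subspaceT => t.
  by apply: continuous_comp; [exact: opp_continuous | exact: continuous_expR].
- by rewrite -[X in _ --> X]oppr0; apply: cvgN; exact: cvgr_expR.
- by move=> t _; exact: (@ex_derive _ _ _ _ _ _ _ (dF t)).
- by apply: cvg_at_right_filter; exact: (is_derive_continuous _ _ _ (dF 0)).
- by move=> t _; rewrite derive1E; exact: (@derive_val _ _ _ _ _ _ _ (dF t)).
Qed.

(** A compact interval away from 0 avoids the singularity of the integrand; the boundary terms are
    added on both sides so that no extended-real subtraction occurs. *)
Lemma gammaf_by_parts x a b : 0 < x -> 0 < a -> a < b ->
  (\int[mu]_(t in `[a, b]) (gammaf (x + 1) t)%:E + (b `^ x * expR (- b))%:E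
   = x%:E * \int[mu]_(t in `[a, b]) (gammaf x t)%:E + (a `^ x * expR (- a))%:E)%E.
Proof.
move=> x0 a0 ab.
have pos t : t \in `[a, b] -> 0 < t by rewrite in_itv/= => /andP[? _]; lra.
pose F t : R := - (t `^ x * expR (- t)).
pose f t : R := gammaf (x + 1) t - x * gammaf x t.
have dF t : 0 < t -> is_derive t 1 F (f t).
  move=> t0.
  have dN : is_derive t (1 : R) (fun s : R => - s) (-1) by exact: is_deriveNid.
  have := @is_derive1_comp R (@expR R) (fun s => - s) t _ _ (is_derive_expR _) dN.
  move=> dc; have dc' : is_derive t 1 (fun s : R => expR (- s)) _ := dc.
  have dp := @is_derive1_powR R x t t0.
  apply: is_derive_eq; rewrite /f /gammaf addrK /GRing.scale/=; ring.
have cf t : 0 < t -> {for t, continuous F}.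
  by move=> t0; exact: (is_derive_continuous _ _ _ (dF t t0)).
have cg y : {within `[a, b], continuous (gammaf y)}.
  apply: continuous_in_subspaceT => t; rewrite inE/= => /pos.
  exact: gammaf_continuous.
have ig y : mu.-integrable `[a, b] (EFin \o gammaf y).
  by apply: continuous_compact_integrable => //; exact: segment_compact.
have fn y : ((\int[mu]_(t in `[a, b]) gammaf y t)%R)%:E
            = (\int[mu]_(t in `[a, b]) (gammaf y t)%:E)%E.
  by rewrite fineK//; exact: (integrable_fin_num _ (ig y)).
rewrite -!fn -EFinM -!EFinD; congr EFin.
suff : \int[mu]_(t in `[a, b]) f t = F b - F a.
  rewrite RintegralB//; last exact: (integrableZl _ x (ig x)).
  rewrite RintegralZl//.
  have aux (u v p q : R) : u - v = - p - - q -> u + p = v + q by lra.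
  exact: aux.
rewrite /Rintegral (@continuous_FTC2 R f F a b ab)//.
- move=> t; apply: continuousB; first exact: cg.
  by apply: continuousM; [exact: cst_continuous | exact: cg].
- split.
  + move=> t tab; have t0 : 0 < t by apply: pos; exact: subset_itv_oo_cc.
    exact: (@ex_derive _ _ _ _ _ _ _ (dF t t0)).
  + by apply: cvg_at_right_filter; apply: cf; lra.
  + by apply: cvg_at_left_filter; apply: cf; lra.
- move=> t tab; have t0 : 0 < t by apply: pos; exact: subset_itv_oo_cc.
  by rewrite derive1E; exact: (@derive_val _ _ _ _ _ _ _ (dF t t0)).
Qed.

End GammaIntegral.

(** * Functional equation, finiteness, positivity and growth of [Gamma] *)

Section GammaFunction.
Context {R : realType}.
Notation mu := (@lebesgue_measure R).
Implicit Types (x y a b d t : R).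

(** The offset between the endpoints keeps every interval nondegenerate, including [n = 0], as
    integration by parts requires. *)
Definition exhaust (n : nat) : set R := `[(n.+1%:R)^-1, n.+2%:R]%classic.

Lemma exhaust_nd : nondecreasing_seq exhaust.
Proof.
move=> m n mn; rewrite subsetEset; apply: subset_itv; rewrite bnd_simp.
  by rewrite lef_pV2 ?posrE// ler_nat.
by rewrite ler_nat.
Qed.

Lemma bigcup_exhaust : \bigcup_n exhaust n = `]0, +oo[%classic.
Proof.
apply/seteqP; split => t /=.
  move=> [n _]; rewrite /exhaust/= !in_itv/= andbT => /andP[+ _].
  by apply: lt_le_trans; rewrite invr_gt0.
rewrite in_itv/= andbT => t0.
pose n := maxn (Num.truncn t^-1) (Num.truncn t).
exists n => //; rewrite /exhaust/= in_itv/=; apply/andP; split.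
  rewrite -[leRHS]invrK lef_pV2 ?posrE ?invr_gt0// ltW//.
  by rewrite (lt_le_trans (truncnS_gt _))// ler_nat ltnS leq_maxl.
rewrite ltW// (lt_le_trans (truncnS_gt _))// ler_nat ltnS.
by rewrite leqW// leq_maxr.
Qed.

Lemma egamma_cvg x :
  (\int[mu]_(t in exhaust n) (gammaf x t)%:E)%E @[n --> \oo] --> egamma x.
Proof.
rewrite /egamma -bigcup_exhaust; apply: ge0_nondecreasing_set_cvg_integral.
- exact: exhaust_nd.
- by move=> n; exact: measurable_itv.
- by move=> n; exact: measurable_gammaf.
- by move=> n t _; rewrite lee_fin gammaf_ge0.
Qed.

(** With [k] the integer part of [x] and [m = n + 2], the exponential series gives
    [e^m >= m^(k+2) / (k+2)!], while [m^x <= m^(k+1)]; the quotient is at most [(k+2)! / m]. *)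
Lemma powR_expR_cvg0 x : 0 < x ->
  n.+2%:R `^ x * expR (- n.+2%:R) @[n --> \oo] --> (0 : R).
Proof.
move=> x0; pose k := Num.truncn x.
have c : k.+2`!%:R * harmonic n @[n --> \oo] --> (0 : R).
  rewrite -[X in _ --> X](mulr0 (k.+2`!%:R)).
  by apply: cvgM; [exact: cvg_cst | exact: cvg_harmonic].
apply: (squeeze_cvgr _ (cvg_cst 0) c); apply: nearW => n.
rewrite mulr_ge0 ?powR_ge0 ?expR_ge0//=.
rewrite expRN ler_pdivrMr ?expR_gt0//.
have e : n.+2%:R ^+ k.+2 / k.+2`!%:R <= expR (n.+2%:R : R).
  by rewrite (le_trans _ (expR_ge1Dxn k.+1 (ler0n _ _)))// lerDr.
rewrite ler_pdivrMr ?ltr0n ?fact_gt0// in e.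
rewrite -mulrA [k.+2`!%:R * _]mulrCA [_ * expR _]mulrC.
apply: (@le_trans _ _ (harmonic n * n.+2%:R ^+ k.+2)); last first.
  by rewrite ler_pM2l ?harmonic_gt0//.
rewrite /harmonic/= mulrC ler_pdivlMr//.
rewrite exprSr; apply: ler_pM => //; last first.
  by rewrite ler_nat.
rewrite -powR_mulrn//; apply: ler_powR; first by rewrite ler1n.
by rewrite ltW// truncnS_gt.
Qed.

Lemma egamma_shift x : 0 < x -> egamma (x + 1) = (x%:E * egamma x)%E.
Proof.
move=> x0.
have l : ((\int[mu]_(t in exhaust n) (gammaf (x + 1) t)%:E)
    + (n.+2%:R `^ x * expR (- n.+2%:R))%:E)%E @[n --> \oo] --> egamma (x + 1).
  rewrite -[X in _ --> X]adde0; apply: cvgeD => //.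
  - by rewrite fin_num_adde_defl.
  - exact: egamma_cvg.
  - by apply: cvg_EFin; [exact: nearW | exact: powR_expR_cvg0].
have r : (x%:E * (\int[mu]_(t in exhaust n) (gammaf x t)%:E)
    + (n.+1%:R^-1 `^ x * expR (- n.+1%:R^-1))%:E)%E @[n --> \oo]
    --> (x%:E * egamma x)%E.
  rewrite -[X in _ --> X]adde0; apply: cvgeD => //.
  - by rewrite fin_num_adde_defl.
  - by apply: cvgeZl => //; exact: egamma_cvg.
  - apply: cvg_EFin; first exact: nearW.
    have c : (n.+1%:R^-1 : R) `^ x @[n --> \oo] --> (0 : R).
      move/cvg_at_rightP : (powR_cvg0 x0); apply; split => [n|].
        by rewrite invr_gt0.
      exact: cvg_harmonic.
    apply: (squeeze_cvgr _ (cvg_cst 0) c); apply: nearW => n.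
    by rewrite mulr_ge0 ?powR_ge0 ?expR_ge0//= ler_piMr ?powR_ge0//.
rewrite -(cvg_lim (@ereal_hausdorff R) l) -(cvg_lim (@ereal_hausdorff R) r).
congr (lim (_ @ \oo)); apply/funext => n /=.
rewrite gammaf_by_parts ?invr_gt0//.
by rewrite (@le_lt_trans _ _ 1) ?invf_le1 ?ler1n ?ltr1n.
Qed.

Lemma egamma_nat (n : nat) : egamma (n.+1%:R : R) \is a fin_num.
Proof.
elim: n => [|n IH]; first by rewrite egamma1.
by rewrite -natr1 egamma_shift// fin_numM.
Qed.

(** For [y >= 1] the integrand is dominated by that of parameter 1 on [t < 1] and by that of an
    integer above [y] on [t >= 1]. For general [x > 0], an infinite [egamma x] would make
    [egamma (x + 1)] infinite. *)
Lemma egamma_fin_num x : 0 < x -> egamma x \is a fin_num.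
Proof.
move=> x0.
have fin1 y : 1 <= y -> egamma y \is a fin_num.
  move=> y1; pose n := Num.truncn y.
  rewrite ge0_fin_numE ?egamma_ge0//.
  apply: (@le_lt_trans _ _ (egamma 1 + egamma n.+1%:R)%E); last first.
    apply: lte_add_pinfty; first by rewrite egamma1 ltry.
    by rewrite -ge0_fin_numE; [exact: egamma_nat | exact: egamma_ge0].
  rewrite /egamma -ge0_integralD//=; last 4 first.
  - by move=> t _; rewrite lee_fin gammaf_ge0.
  - exact: measurable_gammaf.
  - by move=> t _; rewrite lee_fin gammaf_ge0.
  - exact: measurable_gammaf.
  apply: ge0_le_integral => //=.
  - by move=> t _; rewrite lee_fin gammaf_ge0.
  - exact: measurable_gammaf.
  - by apply: emeasurable_funD; exact: measurable_gammaf.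
  move=> t; rewrite in_itv/= andbT => t0; rewrite lee_fin.
  have [t1|t1] := leP 1 t.
    rewrite (@le_trans _ _ (gammaf n.+1%:R t))// ?lerDr ?gammaf_ge0//.
    rewrite /gammaf ler_pM2r ?expR_gt0// ler_powR//.
    by rewrite lerD2r ltW// truncnS_gt.
  rewrite (@le_trans _ _ (gammaf 1 t))// ?lerDl ?gammaf_ge0//.
  rewrite /gammaf ler_pM2r ?expR_gt0//.
  by apply: ger_powR; [rewrite t0 ltW | lra].
have := fin1 (x + 1); rewrite egamma_shift// lerDr => /(_ (ltW x0)).
move: (egamma_ge0 x); case: (egamma x) => // _.
by rewrite gt0_muley.
Qed.

Lemma integrable_gammaf x : 0 < x -> mu.-integrable `]0, +oo[ (EFin \o gammaf x).
Proof.
move=> x0; apply/integrableP; split; first exact: measurable_gammaf.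
under eq_integral do rewrite /= ger0_norm ?gammaf_ge0//.
by rewrite -ge0_fin_numE ?egamma_ge0 ?egamma_fin_num.
Qed.

Lemma GammaE x : Gamma x = fine (egamma x).
Proof. by []. Qed.

Lemma Gamma_shift x : 0 < x -> Gamma (x + 1) = x * Gamma x.
Proof.
by move=> x0; rewrite !GammaE egamma_shift// fineM// egamma_fin_num.
Qed.

Lemma Gamma_gt0 x : 0 < x -> 0 < Gamma x.
Proof.
(* At [x + 1] the exponent of [t] is positive, so on [[1, 2]] the integrand is at least [e^(-2)]. *)
move=> x0; suff : 0 < Gamma (x + 1) by rewrite Gamma_shift// pmulr_rgt0.
have x10 : 0 < x + 1 by lra.
rewrite -lte_fin GammaE fineK ?egamma_fin_num//.
apply: (@lt_le_trans _ _ (\int[mu]_(t in `[1%R, 2%R]) (expR (- 2))%:E)%E).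
  rewrite integral_cst//= lebesgue_measure_itv/= lte_fin ltr1n/=.
  by rewrite -EFinB -EFinM lte_fin mulr_gt0 ?expR_gt0//; lra.
apply: (@le_trans _ _ (\int[mu]_(t in `[1%R, 2%R]) (gammaf (x + 1) t)%:E)%E).
  apply: ge0_le_integral => //=.
  - exact: measurable_gammaf.
  move=> t; rewrite in_itv/= => /andP[t1 t2]; rewrite lee_fin /gammaf addrK.
  rewrite -[leLHS]mul1r ler_pM ?expR_ge0// ?ler_expR; last by lra.
  by rewrite -[leLHS](powRr0 t) ler_powR// ltW.
apply: ge0_subset_integral => //=.
- exact: measurable_gammaf.
- by move=> t _; rewrite lee_fin gammaf_ge0.
- by move=> t /=; rewrite !in_itv/= => /andP[t1 _]; rewrite andbT; lra.
Qed.

(** With [w = ln t], division by [e^(d w)] leaves [1 <= (1 - d) e^(- d w) + d e^((1 - d) w)]. The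
    bound [e^u >= 1 + u] on both exponentials suffices, as the linear terms cancel. *)
Lemma powR_bernoulli d t : 0 < t -> 0 <= d <= 1 -> t `^ d <= 1 + d * (t - 1).
Proof.
move=> t0 /andP[d0 d1]; rewrite /powR gt_eqF//.
set w := ln t; have -> : t = expR w by rewrite lnK.
have h1 := expR_ge1Dx ((1 - d) * w); have h2 := expR_ge1Dx (- (d * w)).
have e1 : expR w = expR (d * w) * expR ((1 - d) * w).
  by rewrite -expRD; congr expR; ring.
have e2 : 1 = expR (d * w) * expR (- (d * w)) by rewrite -expRD subrr expR0.
have p : 0 < expR (d * w) by exact: expR_gt0.
have -> : 1 + d * (expR w - 1) = (1 - d) + d * expR w by ring.
rewrite e1; set A := expR (d * w) in p e2 *; set B := expR (- _) in h2 e2 *.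
set C := expR _ in h1 *.
have -> : (1 - d) + d * (A * C) = A * ((1 - d) * B + d * C).
  by rewrite mulrDr !(mulrCA A) -e2 mulr1.
apply: ler_peMr; first exact: ltW.
have e : 1 = (1 - d) * (1 + - (d * w)) + d * (1 + (1 - d) * w) by ring.
by rewrite [leLHS]e; apply: lerD; rewrite ler_wpM2l//; lra.
Qed.

(* Bernoulli: [t^d <= x^d (1 + d (t/x - 1))], integrated against [t^(x-1) e^(-t)]. *)
Lemma Gamma_increment x d : 0 < x -> 0 <= d <= 1 ->
  Gamma (x + d) <= x `^ d * Gamma x.
Proof.
move=> x0 d01; have /andP[d0 d1] := d01.
have x1 : 0 < x + 1 by lra.
have i0 := integrable_gammaf x x0.
have i1 := integrable_gammaf (x + 1) x1.
pose c0 := x `^ d * (1 - d); pose c1 := x `^ d * (d / x).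
have -> : x `^ d * Gamma x = c0 * Gamma x + c1 * Gamma (x + 1).
  rewrite Gamma_shift// /c0 /c1; field; by rewrite gt_eqF.
have ic0 : mu.-integrable `]0, +oo[ (EFin \o (fun t => c0 * gammaf x t)).
  exact: (integrableZl _ c0 i0).
have ic1 : mu.-integrable `]0, +oo[ (EFin \o (fun t => c1 * gammaf (x + 1) t)).
  exact: (integrableZl _ c1 i1).
rewrite /Gamma -!RintegralZl// -RintegralD//.
apply: le_Rintegral => //.
- by apply: integrable_gammaf; lra.
- exact: (integrableD _ ic0 ic1).
move=> t; rewrite /= in_itv/= andbT => t0.
rewrite -/(gammaf x t) -/(gammaf (x + 1) t) gammafS// /c0 /c1.
have -> : x `^ d * (1 - d) * gammaf x t + x `^ d * (d / x) * (t * gammaf x t) =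
  x `^ d * (1 + d * (t / x - 1)) * gammaf x t by ring.
have -> : t `^ (x + d - 1) * expR (- t) = t `^ d * gammaf x t.
  rewrite /gammaf mulrA -powRD; last by rewrite (gt_eqF t0) implybT.
  by congr (_ `^ _ * _); ring.
rewrite ler_wpM2r ?gammaf_ge0//.
have tx0 : 0 < t / x by rewrite divr_gt0.
have xt : x * (t / x) = t by rewrite mulrCA divff ?mulr1// gt_eqF.
rewrite -[in leLHS]xt (powRM _ (ltW x0) (ltW tx0)) ler_pM2l ?powR_gt0//.
exact: powR_bernoulli.
Qed.

End GammaFunction.

(** * Identification of [digamma] and [trigamma] with [psi] and [psi1] *)

Section GammaDerivatives.
Context {R : realType}.
Implicit Types x : R.

Lemma is_derive_Gamma x : 0 < x -> is_derive x 1 Gamma (Gamma x * psi x).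
Proof.
move=> x0.
have dG : is_derive x 1 (fun y : R => ln (Gamma y)) (psi x).
  apply: is_derive_bohr_mollerup => // [y y0|y d y0 d01].
    by rewrite Gamma_shift// lnM ?posrE ?Gamma_gt0// addrC.
  have /andP[d0 d1] := d01; have yd0 : 0 < y + d by lra.
  have py := powR_gt0 d y0; have gy := Gamma_gt0 y y0.
  rewrite [leRHS]addrC -ln_powR -lnM ?posrE// ler_ln ?posrE ?mulr_gt0 ?Gamma_gt0//.
  exact: Gamma_increment.
have [de ve] := @is_derive1_comp R (@expR R) _ x _ _ (is_derive_expR _) dG.
(* The identity [exp (ln Gamma) = Gamma] is available on the positive axis, so the derivative is
   transferred through equality near [x]. *)
have eG : \forall y \near x, (expR \o (fun y : R => ln (Gamma y))) y = Gamma y.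
  by near=> y; rewrite /= lnK// posrE Gamma_gt0//; near: y; exact: lt_nbhsr.
split.
  by apply: near_eq_derivable de => //; near=> y; apply/esym; near: y.
rewrite -(near_eq_derive _ eG)// ve lnK// posrE Gamma_gt0//.
Unshelve. all: by end_near. Qed.

Lemma digammaE x : 0 < x -> digamma x = psi x.
Proof.
move=> x0; rewrite /digamma derive1E (@derive_val _ _ _ _ _ _ _ (is_derive_Gamma x x0)).
by rewrite mulrC mulKf// gt_eqF// Gamma_gt0.
Qed.

Lemma trigammaE x : 0 < x -> trigamma x = psi1 x.
Proof.
move=> x0; rewrite /trigamma derive1E -(@derive_val _ _ _ _ _ _ _ (is_derive_psi x x0)).
apply: near_eq_derive => //.
by near=> y; apply: digammaE; near: y; exact: lt_nbhsr.
Unshelve. all: by end_near. Qed.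

End GammaDerivatives.

Theorem theorem2p1 (R : realType) (x : R) (hx : 0 < x) :
  1 / 2 * trigamma (alpha x) < ln x - digamma x /\
  ln x - digamma x < 1 / 2 * trigamma (beta x).
Proof.
have a0 : 0 < alpha x by rewrite /alpha; lra.
rewrite digammaE// !trigammaE ?beta_gt0//.
have := psi1_alpha_lt x hx; have := lt_psi1_beta x hx; split; lra.
Qed.
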